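(* Let $K$ be a field, $S=K[x_1,\ldots,x_n]$, let $\Delta$ be a simplicial complex on the set $[n]=\{1,\dots,n\}$ with Stanley-Reisner ideal $I_\Delta\subset S$, and let $t_i=t_i(S/I_\Delta)$ denote the maximal shift in homological degree $i$ of the minimal graded free $S$-resolution of $S/I_\Delta$. Let $a,b$ be non-negative integers such that $a+b\leq \mathrm{proj\,dim}(S/I_\Delta)$. If $\dim(\Delta)<t_a-a$ or $\dim(\Delta)<t_b-b$, then $t_{a+b}\leq t_a+t_b$.
   Context: $S=K[x_1,\ldots,x_n]$ is graded with $\deg(x_i)=1$ for all $i$. The Stanley-Reisner ideal $I_\Delta$ is generated by the squarefree monomials $x_F=\prod_{i\in F}x_i$ with $F\subset[n]$, $F\notin\Delta$. The dimension of a face $F$ is $|F|-1$, and $\dim(\Delta)=\max\{\dim F: F\in\Delta\}$. For a graded ideal $I\subset S$, $\beta_{i,j}(S/I)=\dim_K\mathrm{Tor}_i^S(S/I,K)_j$, and for $0\leq i\leq\mathrm{proj\,dim}(S/I)$ (projective dimension over $S$), $t_i=t_i(S/I):=\max\{j:\beta_{i,j}(S/I)\neq0\}$. *)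

(* Defs.v *)
From HB Require Import structures.
From mathcomp Require Import all_boot all_order all_algebra.
From mathcomp Require Import generic_quotient ring_quotient.
From mathcomp Require Import boolp.
From mathcomp Require Import mpoly.

Set Implicit Arguments.
Unset Strict Implicit.
Unset Printing Implicit Defensive.

Import Order.TTheory GRing.Theory Num.Theory.
Local Open Scope ring_scope.
Local Open Scope quotient_scope.

Section ProjectiveDimension.
Variable R : nzRingType.

Definition surj (A B : Type) (g : A -> B) : Prop := forall y, exists x, g x = y.

Definition exact_at (A B C : lmodType R) (f : A -> B) (g : B -> C) : Prop :=
  forall y : B, g y = 0 <-> exists x, f x = y.

Definition projective (P : lmodType R) : Prop :=
  forall (A B : lmodType R) (g : {linear A -> B}) (h : {linear P -> B}),
    surj g -> exists l : {linear P -> A}, forall x, g (l x) = h x.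

Definition has_proj_resolution (M : lmodType R) (p : nat) : Prop :=
  exists (P : nat -> lmodType R) (d : forall i, {linear P i.+1 -> P i})
         (aug : {linear P 0 -> M}),
    [/\ forall i, projective (P i),
        surj aug,
        exact_at (d 0) aug,
        forall i, exact_at (d i.+1) (d i) &
        forall i, (p < i)%N -> forall x : P i, x = 0].

Definition is_proj_dim (M : lmodType R) (p : nat) : Prop :=
  has_proj_resolution M p /\ forall q, has_proj_resolution M q -> (p <= q)%N.

End ProjectiveDimension.

Section SimplicialComplexes.
Variable n : nat.
Implicit Types (D : {set {set 'I_n}}) (F G : {set 'I_n}).

(* The vertices [set i] are not required to be faces. *)
Definition simplicial_complex D : Prop :=
  set0 \in D /\ forall F G, F \in D -> G \subset F -> G \in D.

Definition face_dim F : int := #|F|%:Z - 1.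

(* The default value -1 is the dimension of the face set0. *)
Definition dim_complex D : int := \big[Order.max/-1]_(F in D) face_dim F.

End SimplicialComplexes.

Section StanleyReisner.
Variables (K : fieldType) (n : nat).
Local Notation S := {mpoly K[n]}.
Variable D : {set {set 'I_n}}.

Definition sqfree_monomial (F : {set 'I_n}) : S := \prod_(i in F) 'X_i.

Definition SR_ideal (f : S) : bool :=
  `[< exists c : {set 'I_n} -> S,
        f = \sum_(F | F \notin D) c F * sqfree_monomial F >].

Lemma SR_idealP f : reflect
  (exists c : {set 'I_n} -> S,
     f = \sum_(F | F \notin D) c F * sqfree_monomial F) (f \in SR_ideal).
Proof. exact: asboolP. Qed.

Lemma SR_ideal_zmod_closed : zmod_closed SR_ideal.
Proof.
split; first by apply/SR_idealP; exists (fun=> 0); rewrite big1// => F _; rewrite mul0r.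
move=> f g /SR_idealP[c ->] /SR_idealP[e ->]; apply/SR_idealP.
exists (fun F => c F - e F); rewrite -sumrB.
by apply: eq_bigr => F _; rewrite mulrBl.
Qed.

HB.instance Definition _ := GRing.isZmodClosed.Build S SR_ideal SR_ideal_zmod_closed.

Lemma SR_idealM (f g : S) : g \in SR_ideal -> f * g \in SR_ideal.
Proof.
move=> /SR_idealP[c ->]; apply/SR_idealP; exists (fun F => f * c F).
by rewrite mulr_sumr; apply: eq_bigr => F _; rewrite mulrA.
Qed.

Definition SR_quot := Quotient.quot (GRing.ZmodClosed.clone S SR_ideal _).

HB.instance Definition _ := GRing.Zmodule.on SR_quot.
HB.instance Definition _ := Quotient.on SR_quot.

Definition SR_pi (f : S) : SR_quot := \pi_(SR_quot) f.

Definition SR_scale (f : S) (x : SR_quot) : SR_quot :=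
  SR_pi (f * repr x).

Lemma SR_pi_eq f g : (SR_pi f = SR_pi g) <-> (f - g \in SR_ideal).
Proof. by rewrite Quotient.idealrBE; split=> /eqP. Qed.

Lemma SR_piD : {morph SR_pi : f g / f + g}.
Proof. by move=> f g; rewrite /SR_pi !piE. Qed.

Lemma SR_pi_repr (x : SR_quot) : SR_pi (repr x) = x.
Proof. exact: reprK. Qed.

Lemma SR_scale_pi f g : SR_scale f (SR_pi g) = SR_pi (f * g).
Proof.
apply/SR_pi_eq; rewrite -mulrBr; apply: SR_idealM.
by apply/SR_pi_eq; rewrite SR_pi_repr.
Qed.

Lemma SR_scaleA f g x : SR_scale f (SR_scale g x) = SR_scale (f * g) x.
Proof. by rewrite -[x]SR_pi_repr !SR_scale_pi mulrA. Qed.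

Lemma SR_scale1 : left_id 1 SR_scale.
Proof. by move=> x; rewrite -[x]SR_pi_repr SR_scale_pi mul1r. Qed.

Lemma SR_scaleDr : right_distributive SR_scale +%R.
Proof.
move=> f x y; rewrite -[x]SR_pi_repr -[y]SR_pi_repr -SR_piD !SR_scale_pi.
by rewrite -SR_piD mulrDr.
Qed.

Lemma SR_scaleDl x : {morph SR_scale^~ x : f g / f + g}.
Proof.
by move=> f g; rewrite -[x]SR_pi_repr !SR_scale_pi -SR_piD mulrDl.
Qed.

HB.instance Definition _ := GRing.Zmodule_isLmodule.Build S SR_quot
  SR_scaleA SR_scale1 SR_scaleDr SR_scaleDl.

Definition SR_degree (j : nat) (x : SR_quot) : Prop :=
  exists2 f : S, f \is j.-homog & x = SR_pi f.

End StanleyReisner.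

Section GradedFreeResolutions.
Variables (K : fieldType) (n : nat).
Local Notation S := {mpoly K[n]}.

(* An element v of the graded free module \bigoplus_k S(- s k) is homogeneous *)
(* of degree j.                                                               *)
Definition free_degree (r : nat) (s : 'I_r -> nat) (j : nat) (v : 'rV[S]_r) : Prop :=
  forall k, if (s k <= j)%N then v 0 k \is (j - s k).-homog else v 0 k == 0.

Variable D : {set {set 'I_n}}.

(* The i-th module is \bigoplus_k S(- shift i k), k < rk i, an element of it  *)
(* is a row vector, and the differential from degree i.+1 to degree i is      *)
(* v |-> v *m diff i. Natural number shifts suffice, as the minimal           *)
(* resolution of S / I_D has no generator of negative degree.                 *)
Record free_complex := FreeComplex {
  rk : nat -> nat;
  shift : forall i, 'I_(rk i) -> nat;
  diff : forall i, 'M[S]_(rk i.+1, rk i);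
  aug : {linear 'rV[S]_(rk 0) -> SR_quot K D}
}.

Implicit Type F : free_complex.

Definition dmap F i (v : 'rV[S]_(rk F i.+1)) : 'rV[S]_(rk F i) := v *m diff F i.

Record graded_free_resolution F : Prop := {
  aug_degree : forall k, SR_degree (shift k) (aug F (delta_mx 0 k));
  diff_degree : forall i k, free_degree (@shift F i) (shift k) (row k (diff F i));
  aug_surj : surj (aug F);
  aug_exact : exact_at (@dmap F 0) (aug F);
  diff_exact : forall i, exact_at (@dmap F i.+1) (@dmap F i)
}.

(* The entries of the differentials lie in the ideal ('X_0, ..., 'X_(n-1)). *)
Definition minimal F : Prop := forall i k l, (diff F i k l)@_0%MM = 0.

(* The complex F \otimes_S K, where K = S / ('X_0, ..., 'X_(n-1)). *)
Definition diffK F i : 'M[K]_(rk F i.+1, rk F i) := map_mx (mcoeff 0%MM) (diff F i).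

Definition degree_part F i (j : nat) : 'M[K]_(rk F i) :=
  diag_mx (\row_k (shift k == j)%:R).

Definition cycles F i : 'M[K]_(rk F i) :=
  match i with 0 => 1%:M | i'.+1 => kermx (diffK F i') end.

(* dim_K Tor_i(S / I_D, K)_j, as the homology of F \otimes_S K. *)
Definition betti F i (j : nat) : nat :=
  \rank (cycles F i :&: degree_part F i j)%MS -
  \rank (degree_part F i.+1 j *m diffK F i).

(* max {j | betti F i j != 0}: the bound on j loses nothing because           *)
(* degree_part F i j = 0 when j exceeds all the shifts of the i-th module.    *)
Definition maxshift F i : nat :=
  \max_(j < (\max_(k < rk F i) shift k).+1 | betti F i j != 0%N) j.

End GradedFreeResolutions.

Arguments aug {K n D}.

(* Main.v *)
(* By Hochster's formula a nonzero Betti number of S / I_D in position (i, j)  *)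
(* forces j - i <= dim D + 1, so the hypothesis makes t_a - a (say) equal to   *)
(* this upper bound, whence t_(a+b) <= t_a + b; and t_b >= b by minimality     *)
(* and because the resolution does not stop before the projective dimension.   *)
(* The upper bound on the shifts only needs that the Koszul homology of        *)
(* S / I_D vanishes in the multidegrees u with u_v > 1 for some v: the part of *)
(* the Koszul complex with u_v > c has a contracting homotopy, which for c = 0 *)
(* gives exactness over S, and for c = 1 preserves squarefree monomial ideals. *)

From HB Require Import structures.
Require Import Defs.
From mathcomp Require Import all_boot all_order all_algebra.
From mathcomp Require Import mpoly zify.

Set Implicit Arguments.
Unset Strict Implicit.
Unset Printing Implicit Defensive.

Import Order.TTheory GRing.Theory Num.Theory.
Local Open Scope ring_scope.

(** Write t_i for [maxshift F i] and d for the largest size of a face, so dim D = d - 1. Every t_i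
    is at most i + d ([shift_le]), and t_i >= i up to the projective dimension ([shift_ge],
    [rank_eq0_proj_resolution]). If t_a - a > d - 1, then t_(a+b) <= a + b + d <= t_a + b <= t_a +
    t_b; the other case is symmetric. The upper bound rests on the two ways of computing Tor. A
    basis vector of degree j of the i-th module is chased through the double complex of F and the
    Koszul complex to a Koszul cycle of S / I_D in exterior degree i and total degree j
    ([koszul_total_exact]). Contracting homotopies ([mcoeff_homotopy], [koszul_split]) leave only
    squarefree multidegrees, where the monomial is supported on a face; hence the cycle bounds once
    j > i + d. *)

Lemma sum_antisym (V : zmodType) (n : nat) (a : 'I_n -> 'I_n -> V) :
  (forall v, a v v = 0) -> (forall v w, v != w -> a v w = - a w v) ->
  \sum_v \sum_w a v w = 0.
Proof.
move=> a0 aN; have splitE (v : 'I_n) :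
    \sum_w a v w = \sum_(w < n | (w < v)%N) a v w
                   + \sum_(w < n | (v < w)%N) a v w.
  rewrite (bigID (fun w : 'I_n => (w < v)%N)) /=; congr (_ + _).
  rewrite (bigD1 v) ?ltnn //= a0 add0r; apply: eq_bigl => w.
  by rewrite -leqNgt ltn_neqAle andbC eq_sym.
under eq_bigr => v _ do rewrite splitE.
rewrite big_split /= [X in _ + X](exchange_big_dep xpredT) //=.
rewrite -big_split /= big1 // => v _.
rewrite -big_split /= big1 // => w ltwv; apply/eqP; rewrite addr_eq0; apply/eqP/aN.
by apply/eqP => vw; rewrite vw ltnn in ltwv.
Qed.

(** * The Koszul complex *)

Section KoszulComplex.
Variables (K : fieldType) (n : nat).
Local Notation S := {mpoly K[n]}.
Implicit Types (T : {set 'I_n}) (v w : 'I_n) (m : 'X_{1..n}).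

(** For [v] outside [T], the sign that sorts e_v wedge e_T into increasing order. *)
Definition koszul_sign v T : K := (-1) ^+ #|[set w in T | (w < v)%N]|.

Lemma koszul_signU v w T : w \notin T ->
  koszul_sign v (w |: T) = (-1) ^+ (w < v)%N * koszul_sign v T.
Proof.
move=> wT; rewrite /koszul_sign -exprD; congr (_ ^+ _).
case ltwv: (w < v)%N.
  rewrite (_ : [set _ in _ | _] = w |: [set u in T | (u < v)%N]).
    by rewrite cardsU1 inE (negPf wT).
  by apply/setP=> u; rewrite !inE; case: eqP => [->|//]; rewrite ltwv.
rewrite add0n; apply: eq_card => u; rewrite !inE.
by case: eqP => [->|//]; rewrite ltwv !andbF.
Qed.

Lemma koszul_sign2 v T : koszul_sign v T * koszul_sign v T = 1.
Proof. by rewrite /koszul_sign -expr2 sqrr_sign. Qed.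

Lemma koszul_signC v w T : v != w -> v \notin T -> w \notin T ->
  koszul_sign w (v |: T) * koszul_sign v T
  = - (koszul_sign v (w |: T) * koszul_sign w T).
Proof.
move=> vw vT wT; rewrite !koszul_signU //.
by case: ltngtP vw => [_ _|_ _|/ord_inj->]; rewrite ?eqxx //=;
  rewrite ?expr0 ?expr1 ?mul1r ?mulN1r ?mulNr ?opprK // mulrC.
Qed.

Lemma koszul_signM v w T : v != w -> v \notin T -> w \notin T ->
  koszul_sign v T * koszul_sign w T
  = - (koszul_sign w (v |: T) * koszul_sign v (w |: T)).
Proof.
move=> vw vT wT; rewrite !koszul_signU //.
by case: ltngtP vw => [_ _|_ _|/ord_inj->]; rewrite ?eqxx //=;
  rewrite ?expr0 ?expr1 ?mul1r ?mulN1r ?mulNr ?opprK ?mulrN ?opprK // mulrC.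
Qed.

(* A chain with coefficients in V is a function on subsets, T indexing the     *)
(* exterior basis vector e_T; all homological degrees are taken together.      *)
Definition koszul (V : lmodType S) (f : {set 'I_n} -> V) T : V :=
  \sum_(v | v \notin T) (koszul_sign v T *: 'X_v) *: f (v |: T).

Section Modules.
Variables V W : lmodType S.

Lemma eq_koszul (f g : {set 'I_n} -> V) : f =1 g -> koszul f =1 koszul g.
Proof. by move=> fg T; apply: eq_bigr => v _; rewrite fg. Qed.

Lemma koszulD (f g : {set 'I_n} -> V) T :
  koszul (fun T => f T + g T) T = koszul f T + koszul g T.
Proof. by rewrite -big_split; apply: eq_bigr => v _; rewrite scalerDr. Qed.

Lemma koszulB (f g : {set 'I_n} -> V) T :
  koszul (fun T => f T - g T) T = koszul f T - koszul g T.
Proof. by rewrite -sumrB; apply: eq_bigr => v _; rewrite scalerBr. Qed.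

Lemma linear_koszul (g : {linear V -> W}) (f : {set 'I_n} -> V) T :
  g (koszul f T) = koszul (fun T => g (f T)) T.
Proof. by rewrite linear_sum; apply: eq_bigr => v _; rewrite linearZ. Qed.

Lemma koszulK (f : {set 'I_n} -> V) T : koszul (koszul f) T = 0.
Proof.
pose a v w := if (v \notin T) && (w \notin v |: T) then
  (koszul_sign v T *: 'X_v) *: ((koszul_sign w (v |: T) *: 'X_w)
     *: f (w |: (v |: T))) else 0.
transitivity (\sum_v \sum_w a v w).
  rewrite /koszul big_mkcond; apply: eq_bigr => v _; rewrite /a.
  case: (v \notin T) => /=; last by rewrite big1.
  by rewrite scaler_sumr -big_mkcond.
apply: sum_antisym => [v | v w vw]; rewrite /a; first by rewrite !inE eqxx andbF.
rewrite !inE !negb_or (eq_sym w v) vw /= andbC; case: ifP; last by rewrite oppr0.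
move=> /andP[wT vT].
rewrite !scalerA setUCA -scaleNr; congr (_ *: _).
rewrite -!scalerAl -!scalerAr !scalerA -scaleNr ['X_w * _]mulrC.
by congr (_ *: _); rewrite mulrC koszul_signC // [in RHS]mulrC.
Qed.

End Modules.

Lemma mcoeffXl v (f : S) m :
  ('X_v * f)@_m = if (0 < m v)%N then f@_(m - U_(v))%MM else 0.
Proof.
rewrite mulrC lt0n -lep1mP; case: ifP => m_v.
  by rewrite -[m in LHS](submK m_v) addmC mcoeffMX.
apply/eqP; rewrite mcoeff_eq0 (perm_mem (msuppMX _ _)); apply/mapP => -[m' _ Em].
by move: m_v; rewrite Em lem_addr.
Qed.

Lemma mcoeff_koszul (f : {set 'I_n} -> S^o) T m :
  (koszul f T : S)@_m = \sum_(v | v \notin T) koszul_sign v T *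
    (if (0 < m v)%N then (f (v |: T) : S)@_(m - U_(v))%MM else 0).
Proof.
rewrite /koszul raddf_sum; apply: eq_bigr => v _ /=.
(* The outer scaling is by S and the inner one by K. *)
have -> : (koszul_sign v T *: 'X_v : S) *: f (v |: T)
          = koszul_sign v T *: ('X_v * (f (v |: T) : S)) :> S by rewrite scalerAl.
by rewrite mcoeffZ mcoeffXl.
Qed.

(* Divides by 'X_v the part of f of degree at least c.+1 in 'X_v. *)
Definition shift_down c v (f : S) : S :=
  \sum_(m <- msupp f | (c < m v)%N) f@_m *: 'X_[m - U_(v)].

Lemma mcoeff_shift_down c v f m :
  (shift_down c v f)@_m = if (c <= m v)%N then f@_(m + U_(v)) else 0.
Proof.
rewrite /shift_down raddf_sum /=.
transitivity (\sum_(m' <- msupp f | m' == (m + U_(v))%MM)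
   if (c <= m v)%N then f@_m' else 0); last first.
  case: ifP => _; last by rewrite big1.
  have [fm|fm] := boolP ((m + U_(v))%MM \in msupp f).
    by rewrite (big_rem _ fm) /= eqxx big_seq_cond big1 ?addr0 // => m' /andP[];
       rewrite mem_rem_uniq ?msupp_uniq // !inE => /andP[/negPf->].
  rewrite memN_msupp_eq0 // big_seq_cond big1 // => m' /andP[fm' /eqP E].
  by rewrite E (negPf fm) in fm'.
rewrite big_mkcond [RHS]big_mkcond; apply: eq_bigr => m' _.
rewrite mcoeffZ mcoeffX.
have [->|neq] := eqVneq m' (m + U_(v))%MM.
  by rewrite addmK eqxx mulr1 mnmDE mnm1E eqxx addn1 ltnS.
case: ifP => // cm'; have [Em|_] := eqVneq; last by rewrite mulr0.
by case/eqP: neq; rewrite -Em submK // lep1mP -lt0n (leq_ltn_trans _ cm').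
Qed.

(** Exterior multiplication by e_v combined with division by 'X_v: the homotopy that contracts the
    part of degree above [c] in direction [v]. *)
Definition contract c v (f : {set 'I_n} -> S) T : S :=
  if v \in T then koszul_sign v (T :\ v) *: shift_down c v (f (T :\ v)) else 0.

Lemma mcoeff_contract c v f T m :
  (contract c v f T)@_m = if (v \in T) && (c <= m v)%N
    then koszul_sign v (T :\ v) * (f (T :\ v))@_(m + U_(v)) else 0.
Proof.
rewrite /contract; case: (v \in T); rewrite ?mcoeff0 //= mcoeffZ mcoeff_shift_down.
by case: ifP; rewrite ?mulr0.
Qed.

(* Here m v + (v \in T) is the degree in 'X_v of 'X_[m] times the basis       *)
(* vector of the exterior algebra indexed by T.                               *)
Lemma mcoeff_homotopy c v (f : {set 'I_n} -> S) T m :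
  (koszul (V := S^o) (contract c v f) T : S)@_m
    + (contract c v (koszul (V := S^o) f) T)@_m
  = if (c < m v + (v \in T))%N then (f T)@_m else 0.
Proof.
rewrite mcoeff_contract !mcoeff_koszul.
have [vT|vT] /= := boolP (v \in T); last first.
  (* [contract] vanishes on sets that miss [v], so only the index [v] contributes. *)
  rewrite addr0 addn0 (bigD1 v) //= big1 ?addr0 => [|w /andP[wT wv]].
    rewrite mcoeff_contract setU11 setU1K // mnmBE mnm1E eqxx /=.
    case m_v: (0 < m v)%N; last by rewrite lt0n in m_v; move/eqP: m_v => ->; rewrite mulr0.
    rewrite leq_subRL // add1n; case: ifP => _; last by rewrite mulr0.
    by rewrite mulrA koszul_sign2 mul1r submK // lep1mP -lt0n.
  by rewrite mcoeff_contract !inE eq_sym (negPf wv) (negPf vT) /= if_same mulr0.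
rewrite addn1 ltnS; case: ifP => cm; last first.
  rewrite addr0 big1 // => w wT; rewrite mcoeff_contract !inE vT orbT /=.
  case: ifP => _; last by rewrite mulr0.
  rewrite mnmBE mnm1E; case: (eqVneq w v) => [wv|_]; first by rewrite wv vT in wT.
  by rewrite subn0 cm mulr0.
(* The index [v] gives back [f T]; every other index occurs in both sums, with opposite signs by
   [koszul_signM]. *)
rewrite [X in _ + _ * X](bigD1 v) ?setD11 //= setD1K // mnmDE mnm1E eqxx addn1 ltn0Sn addmK.
rewrite mulrDr mulrA koszul_sign2 mul1r addrCA -[RHS]addr0; congr (_ + _).
rewrite [X in _ + _ * X](eq_bigl (fun w => w \notin T)); last first.
  by move=> w; rewrite !inE negb_and negbK; case: eqVneq => [->|] /=; rewrite ?vT ?andbF ?andbT.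
rewrite mulr_sumr -big_split big1 //= => w wT.
have wv : w != v by apply: contraNneq wT => ->.
rewrite mcoeff_contract !inE vT orbT /= mnmBE mnmDE !mnm1E (negPf wv).
rewrite [v == w]eq_sym (negPf wv) addn0 subn0 cm.
case: ifP => m_w; last by rewrite !mulr0 addr0.
have -> : (w |: T) :\ v = w |: T :\ v.
  by apply/setP=> u; rewrite !inE; case: (eqVneq u w) => [->|//]; rewrite wv.
rewrite !mulrA.
have -> : (m + U_(v) - U_(w) = m - U_(w) + U_(v))%MM.
  by rewrite ![(_ + U_(v))%MM]addmC addmBA // lep1mP -lt0n.
rewrite -mulrDl -[T in koszul_sign w T](setD1K vT).
by rewrite [X in _ + X]koszul_signM 1?eq_sym ?inE ?eqxx ?wv ?(negPf wT) // subrr mul0r.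
Qed.

(* The total degree mdeg m + #|T| is only required to satisfy E, which avoids  *)
(* subtracting the shifts of the free modules.                                *)
Definition bihomog p (E : pred nat) (z : {set 'I_n} -> S) : Prop :=
  forall T m, (z T)@_m != 0 -> #|T| = p /\ E (mdeg m + #|T|)%N.

Lemma bihomogD p E y z : bihomog p E y -> bihomog p E z ->
  bihomog p E (fun T => y T + z T).
Proof.
move=> hy hz T m; rewrite mcoeffD; have [y0|/hy //] := eqVneq (y T)@_m 0.
by rewrite y0 add0r => /hz.
Qed.

Lemma bihomogN p E y : bihomog p E y -> bihomog p E (fun T => - y T).
Proof. by move=> hy T m; rewrite mcoeffN oppr_eq0 => /hy. Qed.

Lemma bihomog_koszul p E (z : {set 'I_n} -> S) :
  bihomog p.+1 E z -> bihomog p E (koszul (V := S^o) z).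
Proof.
move=> hz T m; rewrite mcoeff_koszul => nz.
have [v /andP[vT zv]] : exists v, (v \notin T) && ((if (0 < m v)%N
    then (z (v |: T))@_(m - U_(v)) else 0) != 0).
  apply/existsP; apply: contraNT nz => /existsPn z0; rewrite big1 // => v vT.
  by move: (z0 v); rewrite vT negbK => /eqP->; rewrite mulr0.
move: zv; case: ifP => [m_v /hz|]; last by rewrite eqxx.
rewrite cardsU1 vT add1n => -[[<-]]; rewrite addnS -addSn -addn1 -(mdeg1 v) -mdegD.
by rewrite submK // lep1mP -lt0n.
Qed.

Lemma bihomog_contract c v p E z : bihomog p E z -> bihomog p.+1 E (contract c v z).
Proof.
move=> hz T m; rewrite mcoeff_contract; case: ifP => [/andP[vT _]|]; last by rewrite eqxx.
rewrite mulf_eq0 negb_or => /andP[_ /hz]; rewrite (cardsD1 v T) vT add1n => -[-> ].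
by rewrite mdegD mdeg1 addnAC addn1 addnS.
Qed.

(** Subtracting the boundary of a contraction, one variable after another, removes every multidegree
    exceeding [c] somewhere. [B] selects the monomials on which [y] is a cycle; it must be stable
    under raising exponents from [c] on, because the contraction reads the boundary of [y] there. *)
Lemma koszul_split c (B : pred 'X_{1..n}) p E (y : {set 'I_n} -> S) :
    (forall m v, (c <= m v)%N -> B m -> B (m + U_(v))%MM) ->
    (forall T m, B m -> (koszul (V := S^o) y T : S)@_m = 0) -> bihomog p E y ->
  exists2 z : {set 'I_n} -> S, bihomog p.+1 E z &
    forall T m, B m -> (y T - koszul (V := S^o) z T)@_m
      = if [forall v, (m v + (v \in T) <= c)%N] then (y T)@_m else 0.
Proof.
move=> Bup y0 hy; suff [z hz zE] : exists2 z : {set 'I_n} -> S, bihomog p.+1 E z &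
    forall T m, B m -> (y T - koszul (V := S^o) z T)@_m
      = if all (fun v => (m v + (v \in T) <= c)%N) (enum 'I_n) then (y T)@_m else 0.
  exists z => // T m Bm; rewrite zE //; congr (if _ then _ else _).
  apply/allP/forallP => h v; last by move=> _; apply: h.
  by apply: h; rewrite mem_enum.
elim: (enum _) => [|v vs [z hz zE]].
  exists (fun=> 0) => [T m|T m _]; first by rewrite mcoeff0 eqxx.
  by rewrite [koszul _ _]big1 ?subr0 // => v _; rewrite scaler0.
pose y1 T : S := y T - koszul (V := S^o) z T.
have hy1 : bihomog p E y1.
  by apply: bihomogD => //; apply/bihomogN/bihomog_koszul.
exists (fun T => z T + contract c v y1 T).
  by apply: bihomogD => //; apply: bihomog_contract.
(* The remainder [y1] has the same boundary as [y], as the Koszul differential squares to zero. *)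
move=> T m Bm; have y10 : (contract c v (koszul (V := S^o) y1) T)@_m = 0.
  rewrite mcoeff_contract; case: ifP => // /andP[_ cm].
  by rewrite /y1 koszulB koszulK subr0 y0 ?mulr0 //; apply: Bup.
have homE := mcoeff_homotopy c v y1 T m; rewrite y10 addr0 in homE.
have -> : y T - koszul (V := S^o) (fun T => z T + contract c v y1 T) T
          = y1 T - koszul (V := S^o) (contract c v y1) T :> S.
  by rewrite /y1 koszulD opprD addrA.
rewrite mcoeffB homE /= [(_ <= c)%N]leqNgt; case: ifP => //= _; first by rewrite subrr.
by rewrite subr0 /y1 zE.
Qed.

(** With c = 0 in [koszul_split] only multidegree 0 survives, that is the constant term at [set0],
    which is zero by hypothesis. *)
Lemma koszul_exact p E (y : {set 'I_n} -> S) :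
    koszul (V := S^o) y =1 (fun=> 0) -> (y set0)@_0%MM = 0 -> bihomog p E y ->
  exists2 z : {set 'I_n} -> S, bihomog p.+1 E z & koszul (V := S^o) z =1 y.
Proof.
move=> dy y0 hy; have [//| T m _ | z hz zE] := @koszul_split 0 predT p E y _ _ hy.
  by rewrite dy mcoeff0.
exists z => // T; apply/esym/eqP; rewrite -subr_eq0; apply/eqP/mpolyP => m.
rewrite mcoeff0 zE //; case: ifP => // /forallP mT0.
have -> : T = set0.
  by apply/setP=> v; move: (mT0 v); rewrite inE; case: (v \in T); rewrite ?addn1.
have -> // : m = 0%MM.
by apply/mnmP => v; move: (mT0 v); rewrite mnm0E leqn0 addn_eq0 => /andP[/eqP].
Qed.

(** * Koszul homology of the Stanley-Reisner ring *)

Section StanleyReisnerIdeal.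
Variable D : {set {set 'I_n}}.
Hypothesis hD : simplicial_complex D.

Definition mnm_support m : {set 'I_n} := [set v | (0 < m v)%N].

(** A monomial with nonface support is divisible by the generator of its support; conversely a
    support containing a nonface is a nonface. *)
Lemma mem_SR_ideal (f : S) :
  f \in SR_ideal D <-> forall m, mnm_support m \in D -> f@_m = 0.
Proof.
have sqfreeE F : sqfree_monomial K F = 'X_[\sum_(v in F) U_(v)].
  by rewrite /sqfree_monomial mprodXE.
have sumE F v : (\sum_(v in F) U_(v))%MM v = (v \in F).
  rewrite mnm_sumE; under eq_bigr => w _ do rewrite mnm1E.
  have [vF|vF] := boolP (v \in F).
    by rewrite (bigD1 v) //= eqxx big1 // => w /andP[_ /negPf->].
  by rewrite big1 // => w wF; case: eqVneq => // E; rewrite -E wF in vF.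
split=> [/SR_idealP[c ->] m mD | f0].
  rewrite raddf_sum big1 //= => F FD; rewrite sqfreeE.
  apply/eqP; rewrite mcoeff_eq0 (perm_mem (msuppMX _ _)); apply/mapP => -[m' _ Em].
  case/negP: FD; apply: hD.2 mD _; apply/subsetP => v vF.
  by rewrite inE Em mnmDE sumE vF.
rewrite [f]mpolyE big_seq; apply: rpred_sum => m fm.
have mD : mnm_support m \notin D.
  by apply/negP => /f0 /eqP; rewrite mcoeff_eq0 fm.
have -> : 'X_[m] = 'X_[m - \sum_(v in mnm_support m) U_(v)]
                   * sqfree_monomial K (mnm_support m).
  rewrite sqfreeE -mpolyXD submK //; apply/mnm_lepP => v.
  by rewrite sumE inE; case: (m v).
rewrite scalerAl; apply: SR_idealM; apply/SR_idealP.
exists (fun F => (F == mnm_support m)%:R); rewrite (bigD1 (mnm_support m)) //= eqxx.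
by rewrite mul1r big1 ?addr0 // => F /andP[_ /negPf->]; rewrite mul0r.
Qed.

(* Modulo the ideal every monomial of degree above the size of all faces is *)
(* divisible by the square of some variable.                                 *)
Lemma koszul_SR_exact p E (y : {set 'I_n} -> S) :
    (forall T, koszul (V := S^o) y T \in SR_ideal D) -> bihomog p E y ->
    (forall e G, E e -> G \in D -> (p + #|G| < e)%N) ->
  exists z : {set 'I_n} -> S,
    forall T, y T - koszul (V := S^o) z T \in SR_ideal D.
Proof.
move=> dy hy hE.
have [|T m mD|z hz zE] :=
    @koszul_split 1 (fun m => mnm_support m \in D) p E y _ _ hy.
(* Raising a positive exponent keeps the support: this is why c = 1 works here. *)
- move=> m v m_v; suff -> : mnm_support (m + U_(v)) = mnm_support m by [].
  apply/setP => w; rewrite !inE mnmDE mnm1E; case: eqVneq => [<-|_].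
    by rewrite addn1 m_v.
  by rewrite addn0.
- by have /mem_SR_ideal := dy T; apply.
exists z => T; apply/mem_SR_ideal => m mD; rewrite zE //.
(* A surviving [m] is squarefree, so its degree is at most the size of its support, a face; this
   contradicts [hE]. *)
case: ifP => // /forallP mT1; apply/eqP; apply: contraT => /hy [Tp].
move=> /hE /(_ mD); rewrite Tp addnC ltn_add2r ltnNge => /negP[].
rewrite mdegE -sum1_card [leqRHS]big_mkcond leq_sum // => v _; rewrite inE.
by have := leq_trans (leq_addr _ _) (mT1 v); case: (m v) => // -[].
Qed.

End StanleyReisnerIdeal.

End KoszulComplex.

(** * Koszul chains with coefficients in free modules *)

Section FreeModuleChains.
Variables (K : fieldType) (n : nat).
Local Notation S := {mpoly K[n]}.

Lemma bihomog_sum (I : finType) p E (z : I -> {set 'I_n} -> S) :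
  (forall i, bihomog p E (z i)) -> bihomog p E (fun T => \sum_i z i T).
Proof.
move=> hz T m nz; have [i] : exists i, (z i T)@_m != 0.
  apply/existsP; apply: contraNT nz => /existsPn z0.
  by rewrite raddf_sum big1 // => i _; apply/eqP; rewrite -[_ == _]negbK z0.
exact: hz.
Qed.

Lemma bihomogMr p E s (z : {set 'I_n} -> S) f :
  bihomog p (fun e => E (e + s)%N) z -> f \is s.-homog ->
  bihomog p E (fun T => z T * f).
Proof.
move=> hz hf T m; rewrite -mcoeff_msupp => /msuppM_le /allpairsP[[m1 m2] /= [zm1 fm2 ->]].
have /dhomogP/(_ _ fm2) fE := hf.
move: zm1; rewrite mcoeff_msupp => /hz[-> Ee]; split=> //.
by rewrite mdegD fE addnAC.
Qed.

Lemma koszulE r (f : {set 'I_n} -> 'rV[S]_r) T l :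
  koszul f T 0 l = koszul (V := S^o) (fun T => f T 0 l) T.
Proof. by rewrite summxE; apply: eq_bigr => v _; rewrite mxE. Qed.

Lemma koszul_exact_row r p (E : 'I_r -> pred nat) (y : {set 'I_n} -> 'rV[S]_r) :
    koszul y =1 (fun=> 0) -> (forall l, (y set0 0 l)@_0%MM = 0) ->
    (forall l, bihomog p (E l) (fun T => y T 0 l)) ->
  exists2 z : {set 'I_n} -> 'rV[S]_r,
    forall l, bihomog p.+1 (E l) (fun T => z T 0 l) & koszul z =1 y.
Proof.
move=> dy y0 hy; have /fin_all_exists2[z hz dz] l : exists2 z : {set 'I_n} -> S,
    bihomog p.+1 (E l) z & koszul (V := S^o) z =1 fun T => y T 0 l.
  by apply: koszul_exact => // T; rewrite -koszulE dy mxE.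
exists (fun T => \row_l z l T) => [l T m|T]; first by rewrite mxE => /hz.
apply/rowP => l; rewrite koszulE -dz.
by apply: (@eq_koszul K n S^o) => T'; rewrite mxE.
Qed.

End FreeModuleChains.

Section Projection.
Variables (K : fieldType) (n : nat) (D : {set {set 'I_n}}).
Local Notation S := {mpoly K[n]}.

(* SR_pi with domain S^o, because {mpoly K[n]} is canonically a K-module. *)
Definition SR_proj (f : S^o) : SR_quot K D := SR_pi D f.

Fact SR_proj_is_linear : linear SR_proj.
Proof. by move=> a x y; rewrite /SR_proj SR_piD -SR_scale_pi. Qed.

HB.instance Definition _ :=
  GRing.isLinear.Build S S^o (SR_quot K D) _ SR_proj SR_proj_is_linear.

Lemma SR_proj_eq0 (f : S) : SR_proj f = 0 <-> f \in SR_ideal D.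
Proof. by rewrite -(linear0 SR_proj) SR_pi_eq subr0. Qed.

End Projection.

(** * Bounds on the shifts *)

Section Regularity.
Variables (K : fieldType) (n : nat) (D : {set {set 'I_n}}).
Local Notation S := {mpoly K[n]}.
Hypothesis hD : simplicial_complex D.
Variable F : free_complex K D.
Hypotheses (hF : graded_free_resolution F) (hmin : minimal F).

Lemma koszul_dmap i (z : {set 'I_n} -> 'rV[S]_(rk F i.+1)) T :
  koszul (fun T => dmap (z T)) T = dmap (koszul z T).
Proof. by have /= := linear_koszul (mulmxr (diff F i)) z T. Qed.

Lemma dmap_dmap i (v : 'rV[S]_(rk F i.+2)) : dmap (dmap v) = 0.
Proof. by apply/(diff_exact hF); exists v. Qed.

Lemma aug_dmap (v : 'rV[S]_(rk F 1)) : aug F (dmap v) = 0.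
Proof. by apply/(aug_exact hF); exists v. Qed.

Lemma dmap_coef0 i (v : 'rV[S]_(rk F i.+1)) l : (dmap v 0 l)@_0%MM = 0.
Proof.
rewrite mxE raddf_sum big1 //= => k _.
by rewrite rmorphM /= hmin mulr0.
Qed.

Lemma bihomog_dmap i p j (z : {set 'I_n} -> 'rV[S]_(rk F i.+1)) :
  (forall k, bihomog p (fun e => e + shift k == j)%N (fun T => z T 0 k)) ->
  forall l, bihomog p (fun e => e + shift l == j)%N (fun T => dmap (z T) 0 l).
Proof.
move=> hz l; have h : bihomog p (fun e => e + shift l == j)%N
    (fun T => \sum_k z T 0 k * diff F i k l).
  apply: bihomog_sum => k; have := diff_degree hF k l; rewrite mxE.
  case: leqP => [lek hd|_ /eqP-> T m]; last by rewrite mulr0 mcoeff0 eqxx.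
  apply: (bihomogMr _ hd) => T m /hz[-> /eqP E]; split=> //.
  by rewrite -addnA subnK // E.
by move=> T m; rewrite mxE => /h.
Qed.

Variable d : nat.
Hypothesis card_face : forall G, G \in D -> (#|G| <= d)%N.

(** Base of the chase: the image of [z] in S / I_D is a cycle, which bounds by [koszul_SR_exact].
    Lifting the bounding chain through [aug] leaves an error in its kernel, the image of [dmap]. *)
Lemma koszul_aug_exact p j (z : {set 'I_n} -> 'rV[S]_(rk F 0)) :
    (forall k, bihomog p (fun e => e + shift k == j)%N (fun T => z T 0 k)) ->
    (p + d < j)%N -> (forall T, aug F (koszul z T) = 0) ->
  exists (w : {set 'I_n} -> 'rV[S]_(rk F 0)) (w' : {set 'I_n} -> 'rV[S]_(rk F 1)),
    forall T, z T = koszul w T + dmap (w' T).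
Proof.
move=> hz ltj dz; have /fin_all_exists2[f hf augf] := aug_degree hF.
pose u T : S := \sum_k z T 0 k * f k.
have uE T : aug F (z T) = SR_proj D (u T).
  rewrite [z T]row_sum_delta (linear_sum (aug F)) /u.
  rewrite (linear_sum (SR_proj D)); apply: eq_bigr => k _.
  by rewrite linearZ augf; apply: SR_scale_pi.
have du T : koszul (V := S^o) u T \in SR_ideal D.
  apply/SR_proj_eq0; rewrite (linear_koszul (SR_proj D)).
  by rewrite -(dz T) linear_koszul; apply: eq_koszul => T'; rewrite uE.
have hu : bihomog p (fun e => e == j) u.
  by apply: bihomog_sum => k; apply: (bihomogMr _ (hf k)).
have [|w wE] := koszul_SR_exact hD du hu.
  by move=> e G /eqP-> /card_face Gd; apply: leq_ltn_trans ltj; rewrite leq_add2l.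
have /fin_all_exists[w0 w0E] T := aug_surj hF (SR_proj D (w T)).
have /fin_all_exists[w' w'E] T : exists v, dmap v = z T - koszul w0 T.
  apply/(aug_exact hF); rewrite linearB linear_koszul uE.
  have /SR_proj_eq0 <- := wE T; rewrite (linearB (SR_proj D)) (linear_koszul (SR_proj D)).
  by rewrite (eq_koszul w0E).
by exists w0, w' => T; rewrite w'E addrC subrK.
Qed.

(* The double complex chase computing Tor by the Koszul resolution of K. *)
Lemma koszul_total_exact q p j (z : {set 'I_n} -> 'rV[S]_(rk F q))
    (y : {set 'I_n} -> 'rV[S]_(rk F q.+1)) :
    (forall k, bihomog p (fun e => e + shift k == j)%N (fun T => z T 0 k)) ->
    (p + q + d < j)%N -> (forall T, koszul z T = dmap (y T)) ->
  exists (w : {set 'I_n} -> 'rV[S]_(rk F q)) (w' : {set 'I_n} -> 'rV[S]_(rk F q.+1)),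
    forall T, z T = koszul w T + dmap (w' T).
Proof.
elim: q p z y => [|q IH] p z y hz ltj dz.
  rewrite addn0 in ltj; apply: (koszul_aug_exact hz ltj) => T.
  by rewrite dz aug_dmap.
(* [dmap] of [z] is a Koszul cycle without constant terms, by minimality, so it bounds some [z'] one
   exterior degree higher; p + q is preserved. *)
have [T|l|l T m|z' hz' dz'] :=
  @koszul_exact_row K n _ p (fun l e => (e + shift l == j)%N) (fun T => dmap (z T)).
- by rewrite koszul_dmap dz dmap_dmap.
- exact: dmap_coef0.
- exact: bihomog_dmap.
have [|w [w' z'E]] := IH _ _ _ hz' _ dz'; first by rewrite addSnnS.
have /fin_all_exists[w'' w''E] T : exists v, dmap v = z T - koszul w' T.
  apply/(diff_exact hF); rewrite /dmap mulmxBl -!/(dmap _).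
  rewrite -koszul_dmap -dz' (eq_koszul z'E) koszulD koszulK add0r.
  by rewrite subrr.
by exists w', w'' => T; rewrite w''E addrC subrK.
Qed.

(** Were the shift larger, the basis vector, placed in exterior degree 0, would be a Koszul boundary
    plus an element of the image of [dmap]. Both have zero constant terms, but the basis vector does
    not. *)
Lemma shift_le i k : (@shift _ _ _ F i k <= i + d)%N.
Proof.
rewrite leqNgt; apply/negP => ltj.
pose z (T : {set 'I_n}) : 'rV[S]_(rk F i) := if T == set0 then delta_mx 0 k else 0.
have [l T m||T|w [w' /(_ set0) /rowP/(_ k)/(congr1 (mcoeff 0%MM))]] :=
  @koszul_total_exact i 0 (shift k) z (fun=> 0).
- rewrite /z; case: (eqVneq T set0) => [->|_]; rewrite !mxE ?mcoeff0 ?eqxx //=.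
  case: (eqVneq l k) => [->|_]; last by rewrite mcoeff0 eqxx.
  rewrite mcoeff1 cards0; case: (eqVneq m 0%MM) => [->|_]; last by rewrite eqxx.
  by rewrite mdeg0 add0n eqxx.
- by rewrite add0n.
- rewrite /dmap mul0mx /koszul big1 // => v _; rewrite /z.
  case: (eqVneq _ set0) => [/setP/(_ v)|_]; last by rewrite scaler0.
  by rewrite setU11 inE.
rewrite /z eqxx mxE !eqxx mcoeff1 eqxx mxE mcoeffD dmap_coef0 koszulE mcoeff_koszul.
by rewrite big1 ?addr0 => [/eqP|v _]; rewrite ?oner_eq0 // mnm0E mulr0.
Qed.

End Regularity.

(** * Free modules are projective; truncating a resolution *)

Section FreeModules.
Variables (R : nzRingType) (r : nat).

Definition row_comb (A : lmodType R) (a : 'I_r -> A) (v : 'rV[R]_r) : A :=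
  \sum_k v 0 k *: a k.

Fact row_comb_is_linear A a : linear (@row_comb A a).
Proof.
move=> c u v; rewrite /row_comb scaler_sumr -big_split; apply: eq_bigr => k _.
by rewrite !mxE scalerDl scalerA.
Qed.

HB.instance Definition _ (A : lmodType R) (a : 'I_r -> A) :=
  GRing.isLinear.Build R _ A _ (@row_comb A a) (@row_comb_is_linear A a).

Lemma projective_row : projective 'rV[R]_r.
Proof.
move=> A B g h gsurj.
have /fin_all_exists[a aE] k : exists x, g x = h (delta_mx 0 k) := gsurj _.
exists (row_comb a) => v; rewrite [v in RHS]row_sum_delta !linear_sum.
by apply: eq_bigr => k _; rewrite !linearZ aE.
Qed.

End FreeModules.

Section Truncation.
Variables (K : fieldType) (n : nat) (D : {set {set 'I_n}}).
Local Notation S := {mpoly K[n]}.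
Variable F : free_complex K D.
Hypothesis hF : graded_free_resolution F.

(** The truncation test is a separate boolean, so that [trunc_diff] is defined by cases without
    casting dimensions. *)
Let trunc_rk (b : bool) i := if b then rk F i else 0%N.

Let trunc_diff b1 b2 i : 'M[S]_(trunc_rk b1 i.+1, trunc_rk b2 i) :=
  match b1, b2 with true, true => diff F i | _, _ => 0 end.

(** The map into the q-th module is zero, so discarding everything above q preserves exactness. *)
Lemma rank_eq0_proj_resolution q : rk F q.+1 = 0%N ->
  has_proj_resolution (SR_quot K D : lmodType S) q.
Proof.
move=> rk0; have dmap0 (v : 'rV[S]_(rk F q.+1)) : dmap v = 0.
  by rewrite /dmap; move: (diff F q) v; rewrite rk0 => M v; rewrite [v]thinmx0 mul0mx.
exists (fun i => 'rV[S]_(trunc_rk (i <= q)%N i)),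
  (fun i => mulmxr (trunc_diff (i < q)%N (i <= q)%N i)), (aug F); split=> [i||y|i|i].
- exact: projective_row.
- exact: aug_surj hF.
- rewrite (aug_exact hF y) /=; case: (posnP q) => [q0|_]; last by [].
  subst q; split=> -[x <-]; exists 0.
    by rewrite /= mul0mx dmap0.
  by rewrite dmap0 /= mulmx0.
(* Exactness at position [i.+1]: unchanged below q, trivial above q, and at q the incoming map is
   zero before and after truncation. *)
- case: (ltngtP i.+1 q) => [lti|gti|eqi].
  + have -> : (i <= q)%N by rewrite ltnW // ltnW.
    exact: diff_exact.
  + move=> y; split=> _; first by exists 0; rewrite [y]thinmx0 linear0.
    by rewrite [y]thinmx0 linear0.
  + subst q; rewrite leqnSn => y /=.
    split=> [y0|[x <-]]; last by rewrite mulmx0 mul0mx.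
    have [x <-] := (diff_exact hF y).1 y0; exists 0.
    by rewrite mul0mx dmap0.
- by rewrite ltnNge => /negPf-> x; rewrite [x]thinmx0.
Qed.

End Truncation.

(** * Shifts and Betti numbers of a minimal resolution *)

Section MinimalResolution.
Variables (K : fieldType) (n : nat) (D : {set {set 'I_n}}).
Variable F : free_complex K D.
Hypotheses (hF : graded_free_resolution F) (hmin : minimal F).

(** A zero row would make the basis vector a cycle, hence a boundary, against minimality. *)
Lemma minimal_row_neq0 i k : row k (diff F i) != 0.
Proof.
apply/eqP => row0; have : dmap (delta_mx 0 k : 'rV_(rk F i.+1)) = 0 :> 'rV_(rk F i).
  by rewrite /dmap -rowE.
move/(diff_exact hF) => [v /rowP/(_ k)/(congr1 (mcoeff 0%MM))].
by rewrite (dmap_coef0 hmin) mxE !eqxx mcoeff1 eqxx => /esym/eqP; rewrite oner_eq0.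
Qed.

(** A nonzero entry of row [k] has positive degree by minimality, so shifts increase strictly along
    it. *)
Lemma shift_ge i k : (i <= @shift _ _ _ F i k)%N.
Proof.
elim: i k => // i IH k.
have /rV0Pn[l] := minimal_row_neq0 k; rewrite mxE => nz.
have := diff_degree hF k l; rewrite mxE.
case: (leqP (shift l) (shift k)) => [le hd|_]; last by rewrite (negPf nz).
apply: (leq_ltn_trans (IH l)); rewrite ltn_neqAle le andbT; apply: contra nz => /eqP E.
move: hd; rewrite -E subnn => hd; apply/eqP/mpolyP => m; rewrite mcoeff0.
have [->|m0] := eqVneq m 0%MM; first exact: hmin.
by apply: dhomog_nemf_coeff hd _; rewrite mdeg_eq0.
Qed.

Lemma betti_neq0 i j : (betti F i j != 0)%N -> exists k, @shift _ _ _ F i k = j.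
Proof.
move=> nz; have [/existsP[k /eqP<-]|/existsPn none] := boolP [exists k, @shift _ _ _ F i k == j].
  by exists k.
case/eqP: nz; rewrite /betti; have -> : degree_part F i j = 0.
  by apply/matrixP => k l; rewrite !mxE (negPf (none _)) mul0rn.
by rewrite capmx0 mxrank0.
Qed.

(** Tensored with K the differentials vanish, so every basis vector survives in Tor. *)
Lemma minimal_betti_shift i k : betti F i (@shift _ _ _ F i k) != 0%N.
Proof.
have diffK0 j : diffK F j = 0 by apply/matrixP => a b; rewrite !mxE hmin.
rewrite /betti diffK0 mulmx0 mxrank0 subn0 mxrank_eq0.
have sub : (degree_part F i (shift k) <= cycles F i :&: degree_part F i (shift k))%MS.
  rewrite sub_capmx submx_refl andbT.
  by case: i k => [|i] k; rewrite ?submx1 // sub_kermx diffK0 mulmx0.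
apply: contraTneq sub => ->; rewrite submx0; apply/eqP => /matrixP/(_ k k)/eqP.
by rewrite !mxE !eqxx oner_eq0.
Qed.

Lemma maxshift_le d i : (forall k, @shift _ _ _ F i k <= d)%N -> (maxshift F i <= d)%N.
Proof.
move=> le; apply/bigmax_leqP => j /betti_neq0[k kE].
by rewrite -kE.
Qed.

Lemma maxshift_ge i k : (@shift _ _ _ F i k <= maxshift F i)%N.
Proof.
have ltk : (shift k < (\max_(k < rk F i) shift k).+1)%N by rewrite ltnS leq_bigmax.
exact: (leq_bigmax_cond (Ordinal ltk)) (minimal_betti_shift k).
Qed.

End MinimalResolution.

Theorem theorem3p3 (K : fieldType) (n : nat) (D : {set {set 'I_n}})
    (hD : simplicial_complex D)
    (F : free_complex K D) (hF : graded_free_resolution F) (hmin : minimal F)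
    (p : nat) (hp : is_proj_dim (SR_quot K D : lmodType {mpoly K[n]}) p)
    (a b : nat) (hab : (a + b <= p)%N) :
  (dim_complex D < (maxshift F a)%:Z - a%:Z \/
   dim_complex D < (maxshift F b)%:Z - b%:Z) ->
  (maxshift F (a + b) <= maxshift F a + maxshift F b)%N.
Proof.
pose d := \max_(G in D) #|G|.
have card_face G : G \in D -> (#|G| <= d)%N by move=> GD; apply: leq_bigmax_cond.
have dim_ge : d%:Z - 1 <= dim_complex D.
  have D_gt0 : (0 < #|D|)%N by apply/card_gt0P; exists set0; apply: hD.1.
  rewrite /d; have [G GD ->] := eq_bigmax_cond (fun G : {set 'I_n} => #|G|) D_gt0.
  exact: le_bigmax_cond.
(* If the module in degree c > 0 were zero, truncation would give a resolution of length c - 1 <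
   p. *)
have lower c : (c <= p)%N -> (c <= maxshift F c)%N.
  case: c => // c ltcp; case: (posnP (rk F c.+1)) => [rk0|rk_gt0].
    by have := hp.2 _ (rank_eq0_proj_resolution hF rk0); rewrite leqNgt ltcp.
  exact: leq_trans (shift_ge hF hmin (Ordinal rk_gt0)) (maxshift_ge hmin _).
have upper : (maxshift F (a + b) <= a + b + d)%N.
  exact/maxshift_le/(shift_le hD hF hmin card_face).
have := lower a (leq_trans (leq_addr _ _) hab).
have := lower b (leq_trans (leq_addl _ _) hab).
by lia.
Qed.
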